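(* Let $(W,S)$ be a Coxeter system of finite rank with Coxeter matrix $(m(s,t))_{s,t\in S}$. For $s,t\in S$ with $m(s,t)<\infty$ let $b(s,t)$ be the largest power of $2$ dividing $m(s,t)$, and let $b(s,t)=\infty$ if $m(s,t)=\infty$. Let $N_b$ be the normal closure in $W$ of all the elements $(st)^{b(s,t)}$ with $s,t\in S$ and $b(s,t)<\infty$, let $W_b=W/N_b$, let $\eta:W\to W_b$ be the quotient homomorphism, and let $S_b=\eta(S)$. Then the pair $(W_b,S_b)$ is a Coxeter system such that if $s$ and $t$ are in $S$, then $\eta(s)=\eta(t)$ if and only if $s$ and $t$ are conjugate in $W$. If $s$ and $t$ are nonconjugate elements of $S$, then the order of $\eta(s)\eta(t)$ is the minimum of the set of all $b(u,v)$ such that $u$ and $v$ are in $S$, $u$ is conjugate to $s$ in $W$, and $v$ is conjugate to $t$ in $W$. In particular, the order of $\eta(s)\eta(t)$ is a power of $2$ or $\infty$.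
   Context: A Coxeter matrix is a symmetric matrix $M=(m(s,t))_{s,t\in S}$ with each $m(s,t)$ a positive integer or $\infty$, and $m(s,t)=1$ if and only if $s=t$. A Coxeter system with Coxeter matrix $M$ is a pair $(W,S)$ where $W$ is a group generated by $S\subset W$ with presentation $W=\langle S \mid (st)^{m(s,t)} : s,t\in S,\ m(s,t)<\infty\rangle$; then $m(s,t)$ is the order of $st$ in $W$. The rank of $(W,S)$ is the cardinality of $S$. The number $1=2^0$ counts as a power of $2$. *)

(* Defs.v *)
From HB Require Import structures.
From mathcomp Require Import all_boot.
From mathcomp Require Import boolp classical_sets functions cardinality.

Set Implicit Arguments.
Unset Strict Implicit.
Unset Printing Implicit Defensive.

Local Open Scope classical_set_scope.
Local Open Scope group_scope.

(** MathComp's [groupType] (possibly infinite groups) extends [choiceType];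
    classically every group carries such a structure. *)

(** Natural numbers extended with infinity, which is [None]. *)
Definition natinf := option nat.

Definition natinf_le (x y : natinf) : bool :=
  match x, y with
  | _, None => true
  | None, Some _ => false
  | Some n, Some k => (n <= k)%N
  end.

Definition is_minimum (A : set natinf) (x : natinf) : Prop :=
  A x /\ (forall y, A y -> natinf_le x y).

Section GroupNotions.
Variable G : groupType.

Definition conjugate (x y : G) : Prop := exists g : G, y = x ^ g.

Definition has_finite_order (x : G) : Prop :=
  exists n : nat, (0 < n)%N && (x ^+ n == 1).

Definition elt_order (x : G) : natinf :=
  if pselect (has_finite_order x) is left h then Some (ex_minn h) else None.

Definition is_normal_subgroup (N : set G) : Prop :=
  [/\ N 1,
      forall x y, N x -> N y -> N (x * y),
      forall x, N x -> N x^-1 &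
      forall x g, N x -> N (x ^ g)].

Record normal_subgroup := NormalSubgroup {
  normal_set :> G -> Prop;
  normal_setP : is_normal_subgroup normal_set }.

Definition normal_closure_set (A : set G) : set G :=
  [set x | forall N : set G, is_normal_subgroup N -> A `<=` N -> N x].

Lemma normal_closure_normal (A : set G) :
  is_normal_subgroup (normal_closure_set A).
Proof.
split.
- by move=> N [].
- move=> x y Ax Ay N nN AN; have [_ NM _ _] := nN.
  by apply: NM; [exact: Ax nN AN | exact: Ay nN AN].
- by move=> x Ax N nN AN; have [_ _ NV _] := nN; exact: NV (Ax _ nN AN).
- by move=> x g Ax N nN AN; have [_ _ _ NJ] := nN; exact: NJ (Ax _ nN AN).
Qed.

Definition normal_closure (A : set G) : normal_subgroup :=
  NormalSubgroup (normal_closure_normal A).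

End GroupNotions.

Section Quotient.
Variables (G : groupType) (N : normal_subgroup G).

Definition coset_rel : rel G := fun x y => `[< N (x^-1 * y) >].

Lemma coset_rel_refl : reflexive coset_rel.
Proof. by move=> x; apply/asboolP; rewrite mulVg; case: (normal_setP N). Qed.

Lemma coset_rel_symm x y : coset_rel x y -> coset_rel y x.
Proof.
have [_ _ NV _] := normal_setP N.
by move=> /asboolP /NV; rewrite invgM invgK => ?; apply/asboolP.
Qed.

Lemma coset_rel_sym : symmetric coset_rel.
Proof. by move=> x y; apply/idP/idP; apply: coset_rel_symm. Qed.

Lemma coset_rel_trans : transitive coset_rel.
Proof.
have [_ NM _ _] := normal_setP N.
move=> y x z /asboolP xy /asboolP yz; apply/asboolP.
by have := NM _ _ xy yz; rewrite -mulgA mulVKg.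
Qed.

Canonical coset_equiv :=
  EquivRel coset_rel coset_rel_refl coset_rel_sym coset_rel_trans.

Definition quotg := {eq_quot coset_equiv}%qT.

HB.instance Definition _ := Choice.on quotg.

Definition quotg_pi : G -> quotg := \pi_quotg%qT.

Lemma quotg_piE x y : quotg_pi x = quotg_pi y <-> N (x^-1 * y).
Proof. by split=> [/eqmodP /asboolP //|Nxy]; apply/eqmodP/asboolP. Qed.

Lemma quotg_piK (a : quotg) : quotg_pi (repr a) = a.
Proof. exact: reprK. Qed.

Definition quotg_mul (a b : quotg) : quotg := quotg_pi (repr a * repr b).
Definition quotg_one : quotg := quotg_pi 1.
Definition quotg_inv (a : quotg) : quotg := quotg_pi (repr a)^-1.

Lemma quotg_mul_pi x y : quotg_mul (quotg_pi x) (quotg_pi y) = quotg_pi (x * y).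
Proof.
have [_ NM NV NJ] := normal_setP N.
apply/quotg_piE; set x' := repr _; set y' := repr _.
have Nx : N (x'^-1 * x) by apply/quotg_piE; rewrite quotg_piK.
have Ny : N (y'^-1 * y) by apply/quotg_piE; rewrite quotg_piK.
suff -> : (x' * y')^-1 * (x * y) = (x'^-1 * x) ^ y' * (y'^-1 * y).
  by apply: NM => //; apply: NJ.
by rewrite conjgE invgM !mulgA mulgK.
Qed.

Lemma quotg_inv_pi x : quotg_inv (quotg_pi x) = quotg_pi x^-1.
Proof.
have [_ NM NV NJ] := normal_setP N.
apply/quotg_piE; set x' := repr _.
have Nx : N (x^-1 * x') by apply/quotg_piE; rewrite quotg_piK.
suff -> : x'^-1^-1 * x^-1 = (x^-1 * x') ^ x^-1 by apply: NJ.
by rewrite conjgE !invgK !mulgA mulgV mul1g.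
Qed.

Lemma quotg_mulA : associative quotg_mul.
Proof.
move=> a b c; rewrite -(quotg_piK a) -(quotg_piK b) -(quotg_piK c).
by rewrite !quotg_mul_pi mulgA.
Qed.

Lemma quotg_mul1 : left_id quotg_one quotg_mul.
Proof. by move=> a; rewrite -(quotg_piK a) quotg_mul_pi mul1g. Qed.

Lemma quotg_mulr1 : right_id quotg_one quotg_mul.
Proof. by move=> a; rewrite -(quotg_piK a) quotg_mul_pi mulg1. Qed.

Lemma quotg_mulV : left_inverse quotg_one quotg_inv quotg_mul.
Proof.
by move=> a; rewrite -(quotg_piK a) quotg_inv_pi quotg_mul_pi mulVg.
Qed.

Lemma quotg_mulrV : right_inverse quotg_one quotg_inv quotg_mul.
Proof.
by move=> a; rewrite -(quotg_piK a) quotg_inv_pi quotg_mul_pi mulgV.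
Qed.

HB.instance Definition _ := isGroup.Build quotg
  quotg_mulA quotg_mul1 quotg_mulr1 quotg_mulV quotg_mulrV.

Lemma quotg_piM : {morph quotg_pi : x y / x * y}.
Proof. by move=> x y; rewrite -quotg_mul_pi. Qed.

Lemma quotg_pi1 : quotg_pi 1 = 1.
Proof. by []. Qed.

HB.instance Definition _ :=
  isUMagmaMorphism.Build G quotg quotg_pi (quotg_pi1, quotg_piM).

Lemma quotg_pi_eq1 x : quotg_pi x = 1 <-> N x.
Proof.
have [_ _ NV _] := normal_setP N.
rewrite -quotg_pi1; split=> [/quotg_piE|Nx]; last first.
  by apply/quotg_piE; rewrite mulg1; apply: NV.
by rewrite mulg1 => /NV; rewrite invgK.
Qed.

End Quotient.

Section Presentation.
Variable I : Type.

(** Group words on the alphabet [I]: the letter [(i, false)] stands for the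
    generator [i] and [(i, true)] for its formal inverse. *)
Definition word := seq (I * bool).

(** [word_eq R v w]: [v] and [w] represent the same element of the group
    < I | R >, i.e. of the free group on [I] modulo the normal closure of [R]. *)
Inductive word_eq (R : set word) : word -> word -> Prop :=
| word_eq_refl w : word_eq R w w
| word_eq_sym v w : word_eq R v w -> word_eq R w v
| word_eq_trans u v w : word_eq R u v -> word_eq R v w -> word_eq R u w
| word_eq_cat v v' w w' :
    word_eq R v v' -> word_eq R w w' -> word_eq R (v ++ w) (v' ++ w')
| word_eq_cancel i e : word_eq R [:: (i, e); (i, ~~ e)] [::]
| word_eq_rel r : R r -> word_eq R r [::].

Variables (G : groupType) (gen : I -> G).

Definition letter_eval (l : I * bool) : G :=
  if l.2 then (gen l.1)^-1 else gen l.1.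

Definition word_eval (w : word) : G := \prod_(l <- w) letter_eval l.

(** [G] has the presentation < I | R > via [gen]: the homomorphism from the
    presented group to [G] induced by [gen] is well defined and bijective. *)
Definition has_presentation (R : set word) : Prop :=
  (forall g : G, exists w : word, word_eval w = g) /\
  (forall w : word, word_eval w = 1 <-> word_eq R w [::]).

End Presentation.

Definition coxeter_matrix (I : Type) (m : I -> I -> natinf) : Prop :=
  [/\ forall s t, m s t = m t s,
      forall s t, m s t <> Some 0%N &
      forall s t, m s t = Some 1%N <-> s = t].

Definition coxeter_relators (I : Type) (m : I -> I -> natinf) : set (word I) :=
  [set r | exists s t n, m s t = Some n /\
     r = flatten (nseq n [:: (s, false); (t, false)])].

Definition coxeter_system_with (W : groupType) (S : set W)
    (m : S -> S -> natinf) : Prop :=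
  coxeter_matrix m /\
  has_presentation (fun s : S => val s : W) (coxeter_relators m).

Definition coxeter_system (W : groupType) (S : set W) : Prop :=
  exists m : S -> S -> natinf, coxeter_system_with m.

(** [n`_2], the 2-part of [n], is the largest power of 2 dividing [n]
    when [n] is positive. *)
Definition two_part (x : natinf) : natinf := omap (fun n : nat => (n`_2)%N) x.

Definition power_of_two_or_inf (x : natinf) : Prop :=
  x = None \/ exists k : nat, x = Some (2 ^ k)%N.

(* Main.v *)
From mathcomp Require Import fingroup perm ssralg zmodp.
Require Import Defs.
From HB Require Import structures.
From mathcomp Require Import all_boot.
From mathcomp Require Import boolp classical_sets functions cardinality.

Set Implicit Arguments.
Unset Strict Implicit.
Unset Printing Implicit Defensive.

Local Open Scope classical_set_scope.
Local Open Scope group_scope.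

(** The quotient [W_b] collapses two generators joined by an odd entry of the
    matrix, and otherwise keeps only the 2-parts of the entries.  The statement
    follows from playing two facts against each other.

    Upper bounds come from the defining relations: [(eta s * eta t) ^+ b(s,t)]
    is trivial, and conjugate generators have the same image, so the order of
    [eta s * eta t] divides [b(u,v)] for all [u], [v] conjugate to [s], [t].

    Lower bounds come from von Dyck's theorem ([von_dyck], [eta_universal]).
    Generators in different classes are joined by an even or infinite entry
    only, and the 2-part of an even number is even.  Hence sending one class of
    generators to an involution [a], another class to an involution [b], and
    all the other generators to 1, respects every relation of [W_b], provided
    that [a * b] satisfies the relations between the two chosen classes
    ([eta_two_classes]).  With a single class and [a] of order 2 this separates
    the classes: taking the class to be a fibre of [eta] shows that conjugate
    generators have the same image, and taking it to be a conjugacy class shows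
    the converse ([eta_conjugate]).  With two classes and [a], [b] reflections
    of the integers modulo [n] whose product is the translation by 1, it shows
    that [n] divides the order of [eta s * eta t] as soon as [n] divides all
    the finite [b(u,v)] ([eta_order_dvd]).  The [b(u,v)] are powers of 2 or
    infinite, so their minimum divides all of them and is therefore the order;
    when the minimum is infinite every [n] qualifies and the order is infinite.
    Because all the finite entries between distinct classes are even, these maps to dihedral
    groups replace the geometric representation of a Coxeter group.

    That [W_b] is a Coxeter group on the image of [S] then needs no formula for
    its matrix: define the entry at [x], [y] as the order of [x * y].  A
    relator of [W], or a generator of [N_b], maps to a power of [x * y] that is
    trivial in [W_b], hence to a power of a Coxeter relator, and
    [quotient_presentation] concludes. *)

(** * Words and their values *)

Section Words.
Context {I : Type}.
Implicit Types (v w : word I) (R : set (word I)).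

Definition word_inv w : word I := rev [seq (l.1, ~~ l.2) | l <- w].

Lemma word_inv_cons l w : word_inv (l :: w) = word_inv w ++ [:: (l.1, ~~ l.2)].
Proof. by rewrite /word_inv map_cons rev_cons -cats1. Qed.

Lemma word_invK : involutive word_inv.
Proof.
move=> w; rewrite /word_inv map_rev revK -map_comp -[RHS]map_id.
by apply: eq_map => -[i e] /=; rewrite negbK.
Qed.

Section Eval.
Variables (G : groupType) (gen : I -> G).

Lemma word_eval_nil : word_eval gen [::] = 1.
Proof. exact: big_nil. Qed.

Lemma word_eval_cat v w :
  word_eval gen (v ++ w) = word_eval gen v * word_eval gen w.
Proof. exact: big_cat. Qed.

Lemma word_eval1 l : word_eval gen [:: l] = letter_eval gen l.
Proof. by rewrite /word_eval big_cons big_nil mulg1. Qed.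

Lemma word_eval_inv w : word_eval gen (word_inv w) = (word_eval gen w)^-1.
Proof.
elim: w => [|[i e] w IHw]; first by rewrite word_eval_nil invg1.
rewrite word_inv_cons -(cat1s _ w) !word_eval_cat !word_eval1 IHw invgM.
by case: e; rewrite /letter_eval //= invgK.
Qed.

Lemma word_eval_pair_power s t n :
  word_eval gen (flatten (nseq n [:: (s, false); (t, false)])) =
    (gen s * gen t) ^+ n.
Proof.
elim: n => [|n IHn]; first exact: word_eval_nil.
by rewrite /= (word_eval_cat [:: _; _]) IHn expgS /word_eval !big_cons
  big_nil mulg1.
Qed.

Lemma word_eq_eval R v w : (forall r, R r -> word_eval gen r = 1) ->
  word_eq R v w -> word_eval gen v = word_eval gen w.
Proof.
move=> R1; elim=> {v w} //.
- by move=> u v w _ -> _.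
- by move=> v v' w w' _ vv' _ ww'; rewrite !word_eval_cat vv' ww'.
- move=> i e; rewrite (word_eval_cat [:: _]) !word_eval1 word_eval_nil.
  by case: e; rewrite /letter_eval /= (mulVg, mulgV).
- by move=> r /R1 ->; rewrite word_eval_nil.
Qed.

End Eval.

Lemma word_eq_mulV R w : word_eq R (w ++ word_inv w) [::].
Proof.
elim: w => [|[i e] w IHw]; first exact: word_eq_refl.
rewrite word_inv_cons catA -cat1s -(catA [:: _]) -(catA [:: _]) /=.
apply: word_eq_trans (word_eq_cancel _ i e).
apply: (@word_eq_cat _ R [:: _] [:: _]); first exact: word_eq_refl.
by apply: (@word_eq_cat _ R _ [::] _ [:: _]) => //; apply: word_eq_refl.
Qed.

End Words.

Definition map_word {I J : Type} (h : I -> J) (w : word I) : word J :=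
  [seq (h l.1, l.2) | l <- w].

Section MapWord.
Variables (I J : Type) (h : I -> J).

Lemma map_word_inv w : map_word h (word_inv w) = word_inv (map_word h w).
Proof. by rewrite /map_word /word_inv map_rev -!map_comp. Qed.

Lemma map_word_eq R R' v w :
  (forall r, R r -> word_eq R' (map_word h r) [::]) ->
  word_eq R v w -> word_eq R' (map_word h v) (map_word h w).
Proof.
move=> RR'; elim=> {v w}.
- by move=> w; apply: word_eq_refl.
- by move=> v w _; apply: word_eq_sym.
- by move=> u v w _ uv _; apply: word_eq_trans.
- by move=> v v' w w' _ vv' _ ww'; rewrite /map_word !map_cat;
    apply: word_eq_cat.
- by move=> i e; apply: word_eq_cancel.
- by move=> r /RR'.
Qed.

End MapWord.

(** * Presentations and their universal property *)

Section Presentations.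
Context {I : Type} {G : groupType} {gen : I -> G} {R : set (word I)}.
Hypothesis presG : has_presentation gen R.

Lemma presentation_relator r : R r -> word_eval gen r = 1.
Proof. by move=> Rr; apply/(proj2 presG); apply: word_eq_rel. Qed.

Lemma presentation_word_eq v w :
  word_eval gen v = word_eval gen w -> word_eq R v w.
Proof.
move=> vw; have /(proj2 presG) : word_eval gen (v ++ word_inv w) = 1.
  by rewrite word_eval_cat word_eval_inv vw mulgV.
move=> vw1; have := word_eq_cat vw1 (word_eq_refl R w).
rewrite -catA => wvw; apply: word_eq_trans wvw.
rewrite -{1}(cats0 v); apply: word_eq_cat; first exact: word_eq_refl.
by apply: word_eq_sym; rewrite -{2}(word_invK w); apply: word_eq_mulV.
Qed.

(** A word representing [g] is determined up to the relations, so evaluating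
    it in [H] does not depend on its choice. *)
Lemma von_dyck (H : groupType) (f : I -> H) :
  (forall r, R r -> word_eval f r = 1) ->
  exists phi : UMagmaMorphism.type G H, forall i, phi (gen i) = f i.
Proof.
move=> R1; pose phi g := word_eval f (projT1 (cid (proj1 presG g))).
have phiE w : phi (word_eval gen w) = word_eval f w.
  rewrite /phi; case: cid => v /= /presentation_word_eq.
  exact: word_eq_eval.
have phi1 : phi 1 = 1 by rewrite -(word_eval_nil gen) phiE word_eval_nil.
have phiM : {morph phi : x y / x * y}.
  move=> x y; have [[v <-] [w <-]] := (proj1 presG x, proj1 presG y).
  by rewrite -word_eval_cat !phiE word_eval_cat.
pose phiMixin := isUMagmaMorphism.Build G H phi (phi1, phiM).
pose phiHom : UMagmaMorphism.type G H := HB.pack phi phiMixin.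
exists phiHom => i; have := phiE [:: (i, false)].
by rewrite !word_eval1.
Qed.

(** Renaming the generators along a surjection [h] is allowed as long as both
    [R] and words for the killed elements [A] become consequences of [R'], and
    [R'] holds in the quotient: no matching of [R'] with [R] and [A] relator by
    relator is required. *)
Lemma quotient_presentation (A : set G) (J : Type) (R' : set (word J))
    (h : I -> J) (gen' : J -> quotg (normal_closure A)) :
    (forall j, exists i, h i = j) ->
    (forall i, gen' (h i) = quotg_pi _ (gen i)) ->
    (forall r, R' r -> word_eval gen' r = 1) ->
    (forall r, R r -> word_eq R' (map_word h r) [::]) ->
    (forall x, A x ->
       exists2 w, word_eval gen w = x & word_eq R' (map_word h w) [::]) ->
  has_presentation gen' R'.
Proof.
move=> h_surj gen'E R'1 RR' AR'.
have evalE w :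
    word_eval gen' (map_word h w) =
      quotg_pi (normal_closure A) (word_eval gen w).
  rewrite /word_eval gmulf_prod big_map; apply: eq_bigr => -[i e] _.
  by rewrite /letter_eval /= gen'E; case: e; rewrite ?gmulfV.
have lift w : exists v, map_word h v = w.
  elim: w => [|[j e] w [v <-]]; first by exists [::].
  by have [i <-] := h_surj j; exists ((i, e) :: v).
split=> [g|w].
  have [w Ew] := proj1 presG (repr g).
  by exists (map_word h w); rewrite evalE Ew quotg_piK.
split; last by move=> /(word_eq_eval R'1) ->; exact: word_eval_nil.
have [{w}w <-] := lift w; rewrite evalE => /quotg_pi_eq1.
(* The elements represented by words that die in < J | R' > form a normal
   subgroup of G, whatever representing words are chosen. *)
pose N : set G := [set x | forall w, word_eval gen w = x ->
  word_eq R' (map_word h w) [::]].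
have NE v : word_eq R' (map_word h v) [::] -> N (word_eval gen v).
  move=> v1 u /presentation_word_eq uv.
  by apply: word_eq_trans v1; apply: map_word_eq uv.
have mapC v u : map_word h (v ++ u) = map_word h v ++ map_word h u.
  exact: map_cat.
suff Nclosure : normal_closure_set A `<=` N by move=> /Nclosure; apply.
move=> x; apply; last by move=> {}x /AR' [v <-]; apply: NE.
split.
- rewrite -(word_eval_nil gen); apply: NE; exact: word_eq_refl.
- move=> y z; have [v <-] := proj1 presG y; have [u <-] := proj1 presG z.
  move=> Nv Nu; rewrite -word_eval_cat; apply: NE; rewrite mapC.
  exact: (word_eq_cat (Nv _ erefl) (Nu _ erefl)).
- move=> y; have [v <-] := proj1 presG y => Nv.
  rewrite -word_eval_inv; apply: NE; rewrite map_word_inv.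
  apply: word_eq_trans (word_eq_mulV R' (map_word h v)).
  apply: (@word_eq_cat _ _ [::]); last exact: word_eq_refl.
  by apply: word_eq_sym; apply: Nv.
- move=> y z; have [v <-] := proj1 presG y; have [u <-] := proj1 presG z.
  move=> Nv; rewrite conjgE -word_eval_inv -!word_eval_cat.
  apply: NE; rewrite !mapC map_word_inv.
  apply: (@word_eq_trans _ _ _
    (word_inv (map_word h u) ++ word_inv (word_inv (map_word h u)))).
    apply: word_eq_cat; first exact: word_eq_refl.
    rewrite word_invK; apply: (@word_eq_cat _ _ _ [::]); last first.
      exact: word_eq_refl.
    exact: Nv.
  exact: word_eq_mulV.
Qed.

End Presentations.

Lemma normal_closure_hom (G H : groupType) (A : set G)
    (phi : UMagmaMorphism.type G H) : (forall x, A x -> phi x = 1) ->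
  forall x y, quotg_pi (normal_closure A) x = quotg_pi (normal_closure A) y ->
    phi x = phi y.
Proof.
move=> A1 x y /quotg_piE /(_ [set z | phi z = 1]) xy.
suff /xy /(_ A1) : is_normal_subgroup [set z : G | phi z = 1].
  by rewrite /mkset gmulfM gmulfV => /mulg1_eq; rewrite invgK.
split=> /= [|u v|u|u v]; first exact: gmulf1.
- by rewrite gmulfM => -> ->; rewrite mulg1.
- by rewrite gmulfV => ->; rewrite invg1.
- by rewrite gmulfJ => ->; rewrite conj1g.
Qed.

(** * Orders of elements and conjugacy *)

Section Orders.
Variable G : groupType.
Implicit Types (x y z : G) (c : natinf).

Lemma elt_order_gt0 x : elt_order x <> Some 0%N.
Proof.
rewrite /elt_order; case: pselect => // h; case: ex_minnP => n.
by case/andP=> n_gt0 _ _ [n0]; rewrite n0 in n_gt0.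
Qed.

(** Reading the infinite order as 0 makes one divisibility statement cover the
    finite and infinite cases, 0 being the only multiple of 0. *)
Lemma expg_eq1_order x k : x ^+ k = 1 <-> odflt 0%N (elt_order x) %| k.
Proof.
rewrite /elt_order; case: pselect => [h|no_h] /=; last first.
  split=> [xk|]; last by rewrite dvd0n => /eqP ->.
  rewrite dvd0n; apply/contraT; rewrite -lt0n => k_gt0; case: no_h.
  by exists k; rewrite k_gt0 xk eqxx.
case: ex_minnP => n /andP[n_gt0 /eqP xn] min_n; split=> [xk|/dvdnP[q ->]].
  have xr : x ^+ (k %% n) = 1.
    by move: xk; rewrite {1}(divn_eq k n) expgnDr mulnC expgnA xn expg1n mul1g.
  rewrite /dvdn -leqn0 leqNgt; apply/negP => r_gt0.
  have := min_n (k %% n); rewrite r_gt0 xr eqxx => /(_ isT).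
  by rewrite leqNgt ltn_mod n_gt0.
by rewrite mulnC expgnA xn expg1n.
Qed.

Lemma elt_orderP x c : c <> Some 0%N ->
  (forall k, x ^+ k = 1 <-> odflt 0%N c %| k) -> elt_order x = c.
Proof.
move=> c_neq0 xP; suff : odflt 0%N (elt_order x) = odflt 0%N c.
  have := @elt_order_gt0 x; case: (elt_order x) c c_neq0 {xP} => [n|] [k|] //=.
  - by move=> _ _ ->.
  - by move=> _ nN0 n0; case: nN0; rewrite n0.
  - by move=> kN0 _ k0; case: kN0; rewrite -k0.
apply/eqP; rewrite eqn_dvd; apply/andP; split.
  by apply/expg_eq1_order/xP; apply: dvdnn.
by apply/xP/expg_eq1_order; apply: dvdnn.
Qed.

Lemma conjugate_refl x : conjugate x x.
Proof. by exists 1; rewrite conjg1. Qed.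

Lemma conjugate_sym x y : conjugate x y -> conjugate y x.
Proof. by case=> g ->; exists g^-1; rewrite conjgK. Qed.

Lemma conjugate_trans x y z :
  conjugate x y -> conjugate y z -> conjugate x z.
Proof. by move=> [g ->] [h ->]; exists (g * h); rewrite conjgM. Qed.

(** In a dihedral group of twice odd order the two standard reflections are
    conjugate. *)
Lemma conjugate_of_odd_order x y n : x * x = 1 -> y * y = 1 -> odd n ->
  (x * y) ^+ n = 1 -> conjugate x y.
Proof.
move=> xx yy n_odd xyn.
have xV : x^-1 = x := mulg1_eq xx; have yV : y^-1 = y := mulg1_eq yy.
have slide k : x * (y * x) ^+ k = (x * y) ^+ k * x.
  elim: k => [|k IHk]; first by rewrite !expg0 mulg1 mul1g.
  by rewrite expgSr mulgA IHk expgSr -!mulgA.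
(* With n = 2k + 1, conjugating x by (y x)^k gives (x y)^(2k) x, which is
   (x y)^-1 x = y. *)
exists ((y * x) ^+ n./2); rewrite conjgE -expVgn invgM xV yV slide mulgA.
rewrite -expgnDr addnn.
have: x * y * (x * y) ^+ n./2.*2 = 1.
  by rewrite -expgS -[RHS]xyn -{2}(odd_double_half n) n_odd add1n.
by move=> /mulg1_eq <-; rewrite invgM xV yV -mulgA xx mulg1.
Qed.

End Orders.

(** * Finite dihedral groups *)

Section Dihedral.
Import GRing.Theory.
Variable n : nat.
Let T := 'I_n.+1.

Lemma dihedral_refl_inj (c : T) : injective (fun x : T => c - x)%R.
Proof. by move=> x y /addrI /oppr_inj. Qed.

(** The reflections of the [n.+1]-gon, acting on its vertices. *)
Definition dihedral_refl (c : T) : {perm T} := perm (@dihedral_refl_inj c).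

Lemma dihedral_refl_mul c d k x :
  ((dihedral_refl c * dihedral_refl d) ^+ k) x = (x + (d - c) *+ k)%R.
Proof.
elim: k => [|k IHk]; first by rewrite expg0 perm1 mulr0n addr0.
by rewrite expgSr !permM IHk !permE mulrSr addrA opprB addrCA addrA.
Qed.

Lemma dihedral_refl_involutive c : dihedral_refl c * dihedral_refl c = 1.
Proof.
by apply/perm.permP=> x; rewrite -[_ * _]expg1 dihedral_refl_mul subrr mul0rn
  addr0 perm1.
Qed.

Lemma dihedral_refl_order k :
  (dihedral_refl 0%R * dihedral_refl (inZp 1)) ^+ k = 1 <-> n.+1 %| k.
Proof.
have rotE x : ((dihedral_refl 0%R * dihedral_refl (inZp 1)) ^+ k) x =
    (x + inZp k)%R :> T.
  rewrite dihedral_refl_mul subr0 Zp_mulrn; congr (_ + _)%R.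
  by apply: val_inj; rewrite /= modnMml mul1n.
split=> [rot1|k0].
  have := rotE 0%R; rewrite rot1 perm1 add0r => /(congr1 val) /= /esym /eqP.
  by [].
apply/perm.permP=> x; rewrite rotE perm1; apply: val_inj => /=.
by rewrite -modnDmr modn_mod (eqP k0) addn0 modn_small.
Qed.

End Dihedral.

(** * Minima and 2-parts *)

Lemma is_minimum_exists (A : set natinf) : A !=set0 -> exists c, is_minimum A c.
Proof.
case=> c0 Ac0; have [[n An]|noA] := pselect (exists n, A (Some n)); last first.
  exists None; split=> [|[n|] // An]; last by case: noA; exists n.
  by case: c0 Ac0 => // n An; case: noA; exists n.
have exA : exists n, `[< A (Some n) >] by exists n; apply/asboolP.
case: (ex_minnP exA) => k /asboolP Ak min_k; exists (Some k).
by split=> // -[j /asboolP /min_k|].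
Qed.

Lemma two_part_odd q : odd q -> (q`_2)%N = 1%N.
Proof.
move=> q_odd; rewrite p_part; suff /eqP -> : logn 2 q == 0%N by [].
by rewrite eqn0Ngt logn_gt0 mem_primes dvdn2 q_odd !andbF.
Qed.

Lemma two_part_even q : (0 < q)%N -> ~~ odd q -> (2 %| q`_2)%N.
Proof.
move=> q_gt0 q_even; rewrite p_part dvdn_exp //.
by rewrite logn_gt0 mem_primes q_gt0 dvdn2 q_even.
Qed.

Lemma two_part_dvd p q : (p`_2 <= q`_2)%N -> (p`_2 %| q`_2)%N.
Proof. by rewrite !p_part leq_exp2l // => /(dvdn_exp2l 2). Qed.

(** * The quotient by the 2-part relations *)

Section CoxeterSystem.
Variables (W : groupType) (S : set W) (m : S -> S -> natinf).
Hypothesis W_coxeter : coxeter_system_with m.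

Local Notation gen s := (val (s : S) : W).

Lemma coxeter_matrix_sym s t : m s t = m t s.
Proof. by case: W_coxeter => -[]. Qed.

Lemma coxeter_matrix_gt0 s t q : m s t = Some q -> (0 < q)%N.
Proof. by case: W_coxeter => -[_ m_neq0 _] _; case: q => // /m_neq0. Qed.

Lemma coxeter_matrix_refl s : m s s = Some 1%N.
Proof. by case: W_coxeter => -[_ _ m1] _; apply/m1. Qed.

Lemma coxeter_relation s t q : m s t = Some q -> (gen s * gen t) ^+ q = 1.
Proof.
move=> mst; rewrite -(word_eval_pair_power (fun s : S => gen s)).
by apply: (presentation_relator (proj2 W_coxeter)); exists s, t, q.
Qed.

Lemma coxeter_involutive s : gen s * gen s = 1.
Proof.
by rewrite -[LHS]expg1; apply: coxeter_relation; apply: coxeter_matrix_refl.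
Qed.

Definition two_part_relations : set W :=
  [set x | exists (s t : S) (n : nat),
     two_part (m s t) = Some n /\ x = (gen s * gen t) ^+ n].

Local Notation eta := (@quotg_pi W (normal_closure two_part_relations)).

Lemma eta_pair_power s t k :
  eta ((gen s * gen t) ^+ k) = (eta (gen s) * eta (gen t)) ^+ k.
Proof. by rewrite gmulfXn gmulfM. Qed.

Lemma eta_relation s t n :
  two_part (m s t) = Some n -> (eta (gen s) * eta (gen t)) ^+ n = 1.
Proof.
move=> bst; rewrite -eta_pair_power; apply/quotg_pi_eq1 => N _ sub.
by apply: sub; exists s, t, n.
Qed.

Lemma eta_involutive s : eta (gen s) * eta (gen s) = 1.
Proof. by rewrite -gmulfM coxeter_involutive. Qed.

Lemma eta_odd s t q : m s t = Some q -> odd q -> eta (gen s) = eta (gen t).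
Proof.
move=> mst q_odd; have /eta_relation : two_part (m s t) = Some 1%N.
  by rewrite mst /= two_part_odd.
rewrite expg1 => /mulg1_eq <-; apply/esym.
exact: (mulg1_eq (eta_involutive s)).
Qed.

Lemma conjugate_odd s t q :
  m s t = Some q -> odd q -> conjugate (gen s) (gen t).
Proof.
move=> mst q_odd.
apply: (conjugate_of_odd_order _ _ q_odd (coxeter_relation mst));
  exact: coxeter_involutive.
Qed.

(** As 2-parts divide the entries of [m], the relations of the quotient imply
    those of [W], so they alone decide whether [f] extends. *)
Lemma eta_universal (H : groupType) (f : S -> H) :
    (forall s t q, m s t = Some q -> (f s * f t) ^+ (q`_2)%N = 1) ->
  exists2 phi : UMagmaMorphism.type W H, forall s, phi (gen s) = f s &
    forall x y, eta x = eta y -> phi x = phi y.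
Proof.
move=> f1; have [|phi phiE] := von_dyck (proj2 W_coxeter) (f := f).
  move=> _ [s [t [q [mst ->]]]]; rewrite word_eval_pair_power.
  have /dvdnP[r ->] := dvdn_part 2 q.
  by rewrite mulnC expgnA (f1 _ _ _ mst) expg1n.
exists phi => //; apply: normal_closure_hom => x [s [t [n [+ ->]]]].
case mst: (m s t) => [q|] //= [<-].
by rewrite gmulfXn gmulfM !phiE (f1 _ _ _ mst).
Qed.

(** Generators joined by an odd entry have the same image, whose square is 1.
    When the entry is even, so is the exponent of the relation, which therefore
    holds as soon as one of the two generators goes to 1 or both go to the same
    involution. *)
Lemma eta_two_classes (H : groupType) (a b : H) (P Q : pred S) :
    a * a = 1 -> b * b = 1 ->
    (forall s t q, m s t = Some q -> odd q -> P s = P t /\ Q s = Q t) ->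
    (forall s t q, m s t = Some q -> P s -> Q t -> (a * b) ^+ (q`_2)%N = 1) ->
  exists2 phi : UMagmaMorphism.type W H,
    forall s, phi (gen s) = if P s then a else if Q s then b else 1 &
    forall x y, eta x = eta y -> phi x = phi y.
Proof.
move=> aa bb oddPQ ab1; pose f s := if P s then a else if Q s then b else 1.
apply: (@eta_universal H f) => s t q mst.
have aV := mulg1_eq aa; have bV := mulg1_eq bb.
have ff u : f u * f u = 1.
  by rewrite /f; case: ifP => // _; case: ifP => //; rewrite mulg1.
have [q_odd|q_even] := boolP (odd q).
  have [Pst Qst] := oddPQ _ _ _ mst q_odd.
  by have -> : f s = f t; rewrite ?ff ?expg1n // /f Pst Qst.
have evenX x : x * x = 1 :> H -> x ^+ (q`_2)%N = 1.
  move=> xx; have /dvdnP[r ->] := two_part_even (coxeter_matrix_gt0 mst) q_even.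
  by rewrite mulnC expgnA expg2 xx expg1n.
have [Ps|nPs] := boolP (P s); have [Pt|nPt] := boolP (P t).
- by rewrite /f Ps Pt aa expg1n.
- rewrite /f Ps (negbTE nPt); case: ifP => [Qt|_]; first exact: ab1 mst _ _.
  by rewrite mulg1 evenX.
- rewrite /f Pt (negbTE nPs); case: ifP => [Qs|_].
    have := ab1 t s q; rewrite coxeter_matrix_sym => /(_ mst Pt Qs) abq.
    apply: invg_inj; rewrite -expVgn invgM aV bV abq.
    by rewrite invg1.
  by rewrite mul1g evenX.
- rewrite /f (negbTE nPs) (negbTE nPt).
  by case: ifP; case: ifP; rewrite ?(mulg1, mul1g, bb, expg1n) // => _ _;
    rewrite evenX.
Qed.

(** The target of the homomorphisms that separate one class of generators from
    the rest. *)
Lemma exists_nontrivial_involution :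
  exists (H : groupType) (a : H), a * a = 1 /\ a <> 1.
Proof.
exists {perm 'I_3}, (dihedral_refl (0%R : 'I_3)); split.
  exact: dihedral_refl_involutive.
move=> /(congr1 (fun p : {perm 'I_3} => val (p (inZp 1)))).
by rewrite /= permE perm1.
Qed.

(** The generators with the same image as [s] are sent to an involution and the
    others to 1; conjugation can neither create nor destroy triviality. *)
Lemma conjugate_eta s t :
  conjugate (gen s) (gen t) -> eta (gen s) = eta (gen t).
Proof.
have [H [a [aa a_neq1]]] := exists_nontrivial_involution.
pose P (u : S) := `[< eta (gen u) = eta (gen s) >].
have [| | |phi phiE _ [g st]] := @eta_two_classes H a 1 P pred0 aa.
- by rewrite mulg1.
- by move=> u v q muv q_odd; rewrite /P (eta_odd muv q_odd).
- by [].
have [/asboolP -> //|nPt] := boolP (P t); case: a_neq1.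
have := phiE t; rewrite (negbTE nPt) /= st gmulfJ phiE.
have -> : P s by apply/asboolP.
by move=> /eqP; rewrite conjg_eq1 => /eqP.
Qed.

(** The same separation, now applied to the conjugacy class of [s]; it descends
    to the quotient, where [s] and [t] are equal. *)
Lemma eta_conjugate s t :
  eta (gen s) = eta (gen t) <-> conjugate (gen s) (gen t).
Proof.
split=> [eta_st|]; last exact: conjugate_eta.
have [H [a [aa a_neq1]]] := exists_nontrivial_involution.
pose P (u : S) := `[< conjugate (gen u) (gen s) >].
have [| | |phi phiE phi_eta] := @eta_two_classes H a 1 P pred0 aa.
- by rewrite mulg1.
- move=> u v q muv q_odd; have uv := conjugate_odd muv q_odd; split=> //.
  apply/asboolP/asboolP; apply: conjugate_trans => //; exact: conjugate_sym.
- by [].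
have := phi_eta _ _ eta_st; rewrite !phiE.
have -> : P s by apply/asboolP; apply: conjugate_refl.
by case: ifP => [/asboolP /conjugate_sym|] //=.
Qed.

(** [s] and [t] go to reflections of the integers modulo [n] whose product is a
    rotation of order [n]; their conjugates follow them and all the other
    generators go to 1. *)
Lemma eta_order_dvd s t n k : (0 < n)%N -> ~ conjugate (gen s) (gen t) ->
    (forall u v q, conjugate (gen u) (gen s) -> conjugate (gen v) (gen t) ->
       m u v = Some q -> (n %| q`_2)%N) ->
  (eta (gen s) * eta (gen t)) ^+ k = 1 -> (n %| k)%N.
Proof.
case: n => // n _ nst n_dvd.
pose a := dihedral_refl (0%R : 'I_n.+1).
pose b := dihedral_refl (inZp 1 : 'I_n.+1).
pose P (u : S) := `[< eta (gen u) = eta (gen s) >].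
pose Q (u : S) := `[< eta (gen u) = eta (gen t) >].
have [| | | |phi phiE phi_eta] := @eta_two_classes _ a b P Q.
- exact: dihedral_refl_involutive.
- exact: dihedral_refl_involutive.
- by move=> u v q muv q_odd; rewrite /P /Q (eta_odd muv q_odd).
- move=> u v q muv /asboolP /eta_conjugate us /asboolP /eta_conjugate vt.
  by apply/dihedral_refl_order; apply: n_dvd muv.
rewrite -eta_pair_power -[1]quotg_pi1 => /phi_eta.
rewrite gmulfXn gmulfM gmulf1 !phiE.
have -> : P s by apply/asboolP.
have -> : Q t by apply/asboolP.
case: ifP => [/asboolP /esym /eta_conjugate //|_].
by move/dihedral_refl_order.
Qed.

Lemma eta_order_minimum s t : ~ conjugate (gen s) (gen t) ->
  is_minimum
    [set c | exists u v : S,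
       [/\ conjugate (gen u) (gen s), conjugate (gen v) (gen t)
         & c = two_part (m u v)]]
    (elt_order (eta (gen s) * eta (gen t))).
Proof.
move=> nst; set B := mkset _.
have [|c [Bc c_min]] := @is_minimum_exists B.
  by exists (two_part (m s t)), s, t; split=> //; apply: conjugate_refl.
suff -> : elt_order (eta (gen s) * eta (gen t)) = c by [].
have [u0 [v0 [us vt c_def]]] := Bc.
apply: elt_orderP => [|k].
  rewrite c_def; case: (m u0 v0) => [q [q0]|] //.
  by have := part_gt0 2 q; rewrite q0.
split.
  case: c c_def c_min {Bc} => [n|] c_def c_min xk /=.
    move: c_def; case: (m u0 v0) => [q0|] // [n_def].
    apply: eta_order_dvd xk => // [|u v q us' vt' muv].
      by rewrite n_def part_gt0.
    rewrite n_def; apply: two_part_dvd; rewrite -n_def.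
    have := c_min (two_part (m u v)); rewrite muv; apply.
    by exists u, v; rewrite muv.
  (* All entries are infinite, so any modulus qualifies; one beyond k forces
     k = 0. *)
  have : (k.+1 %| k)%N.
    apply: eta_order_dvd xk => // u v q us' vt' muv.
    have := c_min (two_part (m u v)); rewrite muv => /=.
    suff Buv : B (Some q`_2)%N by move=> /(_ Buv).
    by exists u, v; rewrite muv.
  by rewrite dvd0n; case: k {xk} => // k; rewrite gtnNdvd.
case: c c_def {Bc c_min} => [n|] c_def /=; last first.
  by rewrite dvd0n => /eqP ->.
move=> /dvdnP[r ->]; rewrite mulnC expgnA.
move/eta_conjugate: us => <-; move/eta_conjugate: vt => <-.
by rewrite eta_relation // expg1n.
Qed.

(** The orders of the products of two generators serve as Coxeter matrix, so
    that every trivial power of such a product is a power of a relator. *)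
Lemma eta_coxeter_system : coxeter_system (eta @` S).
Proof.
set Sb := eta @` S.
have SbP (x : Sb) : exists s : S, eta (gen s) = val x.
  have [s Ss xE] := set_mem (valP x).
  by exists (SigSub (mem_set Ss)).
have SbS (s : S) : eta (gen s) \in Sb.
  by apply/mem_set; exists (gen s) => //; apply: set_mem; apply: valP.
pose h (s : S) : Sb := SigSub (SbS s).
have hP x : exists s, h s = x.
  by have [s sx] := SbP x; exists s; apply: val_inj.
have SbV (x : Sb) : (val x)^-1 = val x.
  have [s <-] := SbP x; exact: mulg1_eq (eta_involutive s).
pose mb (x y : Sb) := elt_order (val x * val y).
exists mb; split.
  split=> x y; last split.
  - apply: elt_orderP; first exact: elt_order_gt0.
    move=> k; rewrite -expg_eq1_order.
    have -> : val x * val y = (val y * val x)^-1 by rewrite invgM !SbV.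
    by rewrite expVgn; split=> [/eqP|->]; rewrite ?invg1 // invg_eq1 => /eqP.
  - exact: elt_order_gt0.
  - move=> mbxy; have := expg_eq1_order (val x * val y) 1.
    rewrite -/(mb x y) mbxy dvdnn expg1 => -[_ /(_ isT) /mulg1_eq].
    by rewrite SbV => /val_inj.
  - move=> <-; apply: elt_orderP => // k /=; rewrite dvd1n -{1}(SbV x) mulVg.
    by rewrite expg1n.
have mb_rel x y k : (val x * val y) ^+ k = 1 ->
    word_eq (coxeter_relators mb)
      (flatten (nseq k [:: (x, false); (y, false)])) [::].
  move/expg_eq1_order; rewrite -/(mb x y).
  case mbxy: (mb x y) => [n|] /=; last first.
    by rewrite dvd0n => /eqP ->; apply: word_eq_refl.
  move=> /dvdnP[r ->]; elim: r => [|r IHr]; first exact: word_eq_refl.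
  rewrite mulSn nseqD flatten_cat; apply: (@word_eq_cat _ _ _ [::] _ [::]) IHr.
  by apply: word_eq_rel; exists x, y, n.
have map_pair (s t : S) k :
    map_word h (flatten (nseq k [:: (s, false); (t, false)])) =
    flatten (nseq k [:: (h s, false); (h t, false)]).
  by rewrite /map_word map_flatten map_nseq.
apply: (quotient_presentation (proj2 W_coxeter) (h := h)) => //.
- move=> _ [x [y [n [mbxy ->]]]]; rewrite word_eval_pair_power.
  by apply/expg_eq1_order; rewrite -/(mb x y) mbxy.
- move=> _ [s [t [q [mst ->]]]]; rewrite map_pair; apply: mb_rel.
  by rewrite /= -eta_pair_power (coxeter_relation mst).
- move=> _ [s [t [n [bst ->]]]].
  exists (flatten (nseq n [:: (s, false); (t, false)])).
    exact: word_eval_pair_power.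
  by rewrite map_pair; apply: mb_rel; apply: eta_relation.
Qed.

End CoxeterSystem.

Theorem proposition4p1 (W : groupType) (S : set W) (m : S -> S -> natinf)
    (S_finite : finite_set S) (W_coxeter : coxeter_system_with m) :
  let b : S -> S -> natinf := fun s t => two_part (m s t) in
  let Nb : normal_subgroup W :=
    normal_closure [set x : W | exists (s t : S) (n : nat),
                      b s t = Some n /\ x = (val s * val t) ^+ n] in
  let Wb : groupType := quotg Nb in
  let eta : W -> Wb := @quotg_pi W Nb in
  let Sb : set Wb := eta @` S in
  [/\ coxeter_system Sb,
      forall s t : S,
        eta (val s) = eta (val t) <-> conjugate (val s) (val t),
      forall s t : S, ~ conjugate (val s) (val t) ->
        is_minimum
          [set c | exists u v : S,
             [/\ conjugate (val u) (val s), conjugate (val v) (val t)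
               & c = b u v]]
          (elt_order (eta (val s) * eta (val t)))
    & forall s t : S, ~ conjugate (val s) (val t) ->
        power_of_two_or_inf (elt_order (eta (val s) * eta (val t)))].
Proof.
move=> b Nb Wb eta Sb; split.
- exact: eta_coxeter_system W_coxeter.
- exact: eta_conjugate W_coxeter.
- exact: eta_order_minimum W_coxeter.
- move=> s t nst; have [] := eta_order_minimum W_coxeter nst.
  move=> [u [v [_ _ order_def]]] _; move: order_def; case: (m u v) => [q|] /=.
    by rewrite p_part => ord_q; right; exists (logn 2 q).
  by left.
Qed.
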